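(* Assume that the problem $\min\{\sum_{i=1}^s f_i(x_i):\sum_{i=1}^sA_ix_i=b,\ x_i\in\mathbb{R}^{n_i},\ i=1,\dots,s\}$ has at least one solution and that $b\in A(\mathrm{ri}(\mathrm{dom}(\sum_{i=1}^sf_i)))$, where $f_i\in\Gamma_0(\mathbb{R}^{n_i})$ and $A_i$ is a real $m\times n_i$ matrix for $i=1,\dots,s$. Let $\alpha_i>0$ for $i=1,\dots,s$ and $\beta>0$. Let $\mathcal{M}=\{M_0,M_1,M_2\}$ be a set of real $(n+m)\times(n+m)$ matrices, and assume that for any $v^k,v^{k-1}\in\mathbb{R}^{n+m}$ there is a unique $v^{k+1}$ satisfying $$v^{k+1}=\mathcal{T}\big((E-R^{-1}M_0)v^{k+1}+R^{-1}M_1v^k+R^{-1}M_2v^{k-1}\big).$$ Let $\{v^k:k\in\mathbb{N}\}$ be generated from this iterative scheme, starting from given $v^0,v^1\in\mathbb{R}^{n+m}$. If $\mathcal{M}$ satisfies Condition-M, then the iterative scheme has $O(\frac1K)$ convergence rate in the partial primal-dual gap sense, that is, $$\mathcal{G}_{B_1\times B_2}(\bar v_K)=O\Big(\frac1K\Big),$$ where $B_1\subseteq\mathbb{R}^n$ and $B_2\subseteq\mathbb{R}^m$ are bounded and $\bar v_K:=\frac1K\sum_{k=2}^{K+1}v^k$.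
   Context: $s,m,n_1,\dots,n_s$ are positive integers, $n=\sum_{i=1}^s n_i$, and $\mathbb{R}^n$ is identified with $\mathbb{R}^{n_1}\times\cdots\times\mathbb{R}^{n_s}$. $\Gamma_0(\mathbb{R}^d)$ is the class of proper lower semicontinuous convex functions $\mathbb{R}^d\to\mathbb{R}\cup\{+\infty\}$. $A=[A_1\ A_2\ \cdots\ A_s]$, $b\in\mathbb{R}^m$, $C=\{b\}$, and $\iota_C$ is the indicator function of $C$ ($0$ on $C$, $+\infty$ elsewhere). $\sum_{i=1}^s f_i$ denotes the function $x=(x_1,\dots,x_s)\mapsto\sum_{i=1}^sf_i(x_i)$ on $\mathbb{R}^n$, and $\mathrm{dom}$ is the set where a function is finite. For a set $S$, $\mathrm{ri}(S)=\{x\in S:\mathrm{cone}(S-x)=\mathrm{span}(S-x)\}$ is its relative interior, where $\mathrm{cone}(S)$ is the smallest cone containing $S$. $\varphi^*(y)=\sup_x\{\langle x,y\rangle-\varphi(x)\}$ is the conjugate of $\varphi$, and $\mathrm{prox}_\varphi(x)=\mathrm{argmin}_u\{\frac12\|u-x\|_2^2+\varphi(u)\}$ is its proximity operator. For $v=(x_1,\dots,x_s,y)\in\mathbb{R}^{n_1}\times\cdots\times\mathbb{R}^{n_s}\times\mathbb{R}^m$, $$\mathcal{T}(v)=\big(\mathrm{prox}_{\frac{\alpha_1}{\beta}f_1}(x_1),\dots,\mathrm{prox}_{\frac{\alpha_s}{\beta}f_s}(x_s),\mathrm{prox}_{\beta\iota_C^*}(y)\big).$$ $P=\mathrm{diag}(\frac{\beta}{\alpha_1}I_{n_1},\dots,\frac{\beta}{\alpha_s}I_{n_s})$,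 $R=\mathrm{diag}(P,\frac1\beta I_m)$, $E=\begin{bmatrix}I&-P^{-1}A^\top\\ \beta A&I\end{bmatrix}$. Condition-M for a set $\{M_0,M_1,M_2\}$ of $d\times d$ matrices: (i) $M_0=M_1+M_2$; (ii) $H:=M_0+M_2$ is symmetric positive definite; (iii) $\|H^{-1/2}M_2H^{-1/2}\|_2<\frac12$, where $\|\cdot\|_2$ is the largest singular value. For bounded sets $B_1\subseteq\mathbb{R}^n$, $B_2\subseteq\mathbb{R}^m$, the partial primal-dual gap at $v=(x,y)$, $x=(x_1,\dots,x_s)\in\mathbb{R}^n$, $y\in\mathbb{R}^m$, is $$\mathcal{G}_{B_1\times B_2}(v)=\max\Big\{\sum_{i=1}^sf_i(x_i)-\iota_C^*(y')+\langle Ax,y'\rangle:y'\in B_2\Big\}-\min\Big\{\sum_{i=1}^sf_i(x_i')-\iota_C^*(y)+\langle Ax',y\rangle:x'\in B_1\Big\}.$$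
   Formalization: The O(1/K) rate is stated as an upper bound, gap at most c/K for all K ≥ 1, not a bound on its absolute value: for arbitrary bounded B1, B2 without a saddle point the gap can stay negative (e.g. −1/2). Max and min are read as sup and inf. *)

(* Defs.v *)
(* MathComp-Analysis.  Vectors of R^d are column vectors 'cV[R]_d; R^n with
   n = n_1 + ... + n_s is 'cV[R]_(\sum_i n_ i), with blocks [submxcol x i] and
   assembly [\mxcol_i x_ i]; R^n x R^m is 'cV[R]_(\sum_i n_ i + m), with parts
   [usubmx v], [dsubmx v] and assembly [col_mx x y]. *)
From HB Require Import structures.
From mathcomp Require Import all_boot all_order all_algebra.
From mathcomp Require Import all_classical all_reals all_analysis.

Set Implicit Arguments.
Unset Strict Implicit.
Unset Printing Implicit Defensive.

Import Order.TTheory GRing.Theory Num.Theory.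
Import numFieldNormedType.Exports.

Local Open Scope classical_set_scope.
Local Open Scope ring_scope.

Section Euclidean.
Context {R : realType} {d : nat}.
Implicit Types (x y u : 'cV[R]_d) (S V : set 'cV[R]_d) (M : 'M[R]_d).

Definition dotp x y : R := \sum_(i < d) x i 0 * y i 0.

(* The library norm of 'cV[R]_d is the sup norm, hence this separate one. *)
Definition norm2 x : R := Num.sqrt (dotp x x).

Definition is_cone V : Prop :=
  forall (t : R) x, 0 < t -> V x -> V (t *: x).

Definition is_subspace V : Prop :=
  V 0 /\ forall (a : R) x y, V x -> V y -> V (a *: x + y).

Definition cone_hull S : set 'cV[R]_d := smallest is_cone S.

Definition span_hull S : set 'cV[R]_d := smallest is_subspace S.

Definition translate S x : set 'cV[R]_d := [set z - x | z in S].

Definition ri S : set 'cV[R]_d :=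
  [set x | S x /\ cone_hull (translate S x) = span_hull (translate S x)].

Definition sym_posdef M : Prop :=
  M^T = M /\ forall x, x != 0 -> 0 < dotp x (M *m x).

(* A symmetric positive definite matrix has exactly one symmetric positive
   definite square root; [xget] selects it (and returns 0 on matrices that
   have none). *)
Definition sqrtmx M : 'M[R]_d :=
  xget 0 [set S : 'M[R]_d | sym_posdef S /\ S *m S = M].

Definition invsqrtmx M : 'M[R]_d := invmx (sqrtmx M).

Definition singular_value M : set R :=
  [set t | 0 <= t /\ eigenvalue (M^T *m M) (t ^+ 2)].

(* For d > 0 the set of singular values is finite and nonempty, so that the
   supremum is the largest one. *)
Definition spectral_norm M : R := sup (singular_value M).

Definition condition_M (M0 M1 M2 : 'M[R]_d) : Prop :=
  let H := M0 + M2 in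
  [/\ M0 = M1 + M2,
      sym_posdef H
    & spectral_norm (invsqrtmx H *m M2 *m invsqrtmx H) < 2^-1].

End Euclidean.

Section Convex.
Context {R : realType} {d : nat}.
Implicit Types (f phi : 'cV[R]_d -> \bar R) (C : set 'cV[R]_d).
Local Open Scope ereal_scope.

Definition dom f : set 'cV[R]_d := [set x | f x \is a fin_num].

Definition proper_fun f : Prop := (forall x, f x != -oo) /\ (exists x, f x < +oo).

Definition econvex f : Prop :=
  forall (x y : 'cV[R]_d) (t : R), (0 < t < 1)%R ->
    f (t *: x + (1 - t) *: y)%R <= t%:E * f x + (1 - t)%:E * f y.

Definition Gamma0 f : Prop :=
  [/\ proper_fun f, lower_semicontinuous f & econvex f].

Definition indicator C : 'cV[R]_d -> \bar R :=
  fun x => if x \in C then 0 else +oo.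

Definition conjugate phi : 'cV[R]_d -> \bar R :=
  fun y => ereal_sup [set (dotp x y)%:E - phi x | x in [set: 'cV[R]_d]].

Definition escale (c : R) phi : 'cV[R]_d -> \bar R := fun x => c%:E * phi x.

Definition argmin phi : set 'cV[R]_d := [set u | forall w, phi u <= phi w].

(* For phi in Gamma0 the argmin is a singleton, whose element [xget] returns. *)
Definition prox phi (x : 'cV[R]_d) : 'cV[R]_d :=
  xget 0%R (argmin (fun u => (2^-1 * norm2 (u - x)%R ^+ 2)%:E + phi u)).

End Convex.

Section Scheme.
Context {R : realType} {s m : nat} {n_ : 'I_s -> nat}.
Variables (f : forall i, 'cV[R]_(n_ i) -> \bar R).
Variables (A : forall i, 'M[R]_(m, n_ i)) (b : 'cV[R]_m).
Variables (alpha : 'I_s -> R) (beta : R).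

Local Notation n := (\sum_(i < s) n_ i)%N.

Definition fsum (x : 'cV[R]_n) : \bar R :=
  (\sum_(i < s) f (submxcol x i))%E.

Definition Amx : 'M[R]_(m, n) := \mxrow_i A i.

Definition feasible (x : 'cV[R]_n) : Prop :=
  \sum_(i < s) A i *m submxcol x i = b.

Definition solution (x : 'cV[R]_n) : Prop :=
  feasible x /\ forall x', feasible x' -> (fsum x <= fsum x')%E.

Definition iotaC_conj : 'cV[R]_m -> \bar R := conjugate (indicator [set b]).

Definition Tmap (v : 'cV[R]_(n + m)) : 'cV[R]_(n + m) :=
  col_mx
    (\mxcol_i prox (escale (alpha i / beta) (@f i)) (submxcol (usubmx v) i))
    (prox (escale beta iotaC_conj) (dsubmx v)).

Definition Pmx : 'M[R]_n := \mxdiag_i ((beta / alpha i)%:M : 'M[R]_(n_ i)).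

Definition Rmx : 'M[R]_(n + m) := block_mx Pmx 0 0 (beta^-1)%:M.

Definition Emx : 'M[R]_(n + m) :=
  block_mx 1%:M (- (invmx Pmx *m Amx^T)) (beta *: Amx) 1%:M.

(* v2, v1, v0 stand for v^{k+1}, v^k, v^{k-1}; the equation is implicit in v2. *)
Definition scheme_step (M0 M1 M2 : 'M[R]_(n + m)) (v2 v1 v0 : 'cV[R]_(n + m)) :
    Prop :=
  v2 = Tmap ((Emx - invmx Rmx *m M0) *m v2 + invmx Rmx *m M1 *m v1
            + invmx Rmx *m M2 *m v0).

(* As B1 and B2 need not be closed, max and min are the supremum and infimum
   in the extended reals.  The gap is nonnegative when B1 x B2 contains a
   saddle point but may be negative otherwise, so a rate for it is an upper
   bound. *)
Definition partial_gap (B1 : set 'cV[R]_n) (B2 : set 'cV[R]_m)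
    (v : 'cV[R]_(n + m)) : \bar R :=
  let x := usubmx v in let y := dsubmx v in
  (ereal_sup [set fsum x - iotaC_conj y' + (dotp (Amx *m x) y')%:E | y' in B2]
   - ereal_inf [set fsum x' - iotaC_conj y + (dotp (Amx *m x') y)%:E
                | x' in B1])%E.

Definition ergodic_mean (v : nat -> 'cV[R]_(n + m)) (K : nat) :
    'cV[R]_(n + m) :=
  K%:R^-1 *: \sum_(2 <= k < K.+2) v k.

End Scheme.

(* Main.v *)
Require Import Defs.
From HB Require Import structures.
From mathcomp Require Import all_boot all_order all_algebra.
From mathcomp Require Import finmap.
From mathcomp Require Import all_classical all_reals all_analysis.
From mathcomp Require Import complex spectral ring lra.

Set Implicit Arguments.
Unset Strict Implicit.
Unset Printing Implicit Defensive.

Import Order.TTheory GRing.Theory Num.Theory.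
Import numFieldNormedType.Exports.

Local Open Scope classical_set_scope.
Local Open Scope ring_scope.

(** Let [v0, v1, v2] be consecutive iterates, [q = M0 v2 - M1 v1 - M2 v0] and
    [L] the Lagrangian, so that the gap at [(x, y)] is the supremum of
    [L (x, y') - L (x', y)] over [B1 x B2]. After multiplication by [Rmx], the
    implicit equation says that [v2] solves proximal subproblems; the
    subgradients they provide, added up over the blocks and the multiplier, give
    at [v2 = (x, y)], for every comparison point [p = (x', y')],
    [L (x, y') - L (x', y) <= <q, p - v2>] ([scheme_step_gap_le]), the terms in
    [A] cancelling by skew symmetry.

    With [H = M0 + M2] and the increments [d2 = v2 - v1], [d1 = v1 - v0], the
    residual is [q = H d2 - M2 (d2 - d1)]. The bound on the spectral norm says
    that [|<a, M2 e>| <= (|a|_H^2 + |e|_H^2) / 4] ([cross_term_le]). This is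
    what makes
    [|p - v1|_H^2 / 2 + <p - v1, M2 d1> + |d1|_H^2 / 4]
    nonnegative, and decreasing by at least [<q, p - v2>] when [(v1, v0)] is
    replaced by [(v2, v1)] ([energy_ge0], [energy_step]). The sum over [K] steps
    of the gaps against [p] is thus at most the initial energy, which is bounded
    for [p] in [B1 x B2]. Dividing by [K], and using Jensen's inequality for the
    convex part of [L] and linearity for the rest, gives the rate
    ([gap_ergodic_mean]).

    Two facts about chosen objects have to be established. The square root of
    [H] exists, and the supremum of the singular values controls the quadratic
    form, by functional calculus on a symmetric matrix ([sym_fourth_root]). The
    proximity operator of a function of [Gamma0] is attained, because such a
    function has a lower bound that is linear in the distance
    ([Gamma0_linear_lower_bound]) and attains its minimum on compact sets
    ([lsc_min_compact]). *)

(** * The Euclidean product and the sup norm *)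

Section DotProduct.
Context {R : realType}.

Lemma dotpE d (x y : 'cV[R]_d) : dotp x y = (x^T *m y) 0 0.
Proof. by rewrite mxE; apply: eq_bigr => i _; rewrite mxE. Qed.

Lemma dotpC d (x y : 'cV[R]_d) : dotp x y = dotp y x.
Proof. by apply: eq_bigr => i _; rewrite mulrC. Qed.

Lemma dotpDr d (x y z : 'cV[R]_d) : dotp x (y + z) = dotp x y + dotp x z.
Proof. by rewrite !dotpE mulmxDr mxE. Qed.

Lemma dotpNr d (x y : 'cV[R]_d) : dotp x (- y) = - dotp x y.
Proof. by rewrite !dotpE mulmxN mxE. Qed.

Lemma dotpZr d (a : R) (x y : 'cV[R]_d) : dotp x (a *: y) = a * dotp x y.
Proof. by rewrite !dotpE -scalemxAr mxE. Qed.

Lemma dotpDl d (x y z : 'cV[R]_d) : dotp (y + z) x = dotp y x + dotp z x.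
Proof. by rewrite dotpC dotpDr !(dotpC x). Qed.

Lemma dotpNl d (x y : 'cV[R]_d) : dotp (- y) x = - dotp y x.
Proof. by rewrite dotpC dotpNr dotpC. Qed.

Lemma dotpZl d (a : R) (x y : 'cV[R]_d) : dotp (a *: y) x = a * dotp y x.
Proof. by rewrite dotpC dotpZr dotpC. Qed.

Lemma dotp0r d (x : 'cV[R]_d) : dotp x 0 = 0.
Proof. by rewrite dotpE mulmx0 mxE. Qed.

Lemma dotp_sumr d (I : Type) (r : seq I) (P : pred I) (F : I -> 'cV[R]_d) x :
  dotp x (\sum_(i <- r | P i) F i) = \sum_(i <- r | P i) dotp x (F i).
Proof.
by elim/big_rec2: _ => [|i a b _ <-]; rewrite ?dotp0r ?dotpDr.
Qed.

Lemma dotp_mulmxr d e (x : 'cV[R]_d) (M : 'M[R]_(d, e)) (y : 'cV[R]_e) :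
  dotp x (M *m y) = dotp (M^T *m x) y.
Proof. by rewrite !dotpE trmx_mul trmxK mulmxA. Qed.

Lemma dotp_mulmxl d e (M : 'M[R]_(d, e)) (x : 'cV[R]_e) (y : 'cV[R]_d) :
  dotp (M *m x) y = dotp x (M^T *m y).
Proof. by rewrite dotp_mulmxr trmxK. Qed.

Lemma dotp_ge0 d (x : 'cV[R]_d) : 0 <= dotp x x.
Proof. by apply: sumr_ge0 => i _; rewrite -expr2 sqr_ge0. Qed.

Lemma dotp_gt0 d (x : 'cV[R]_d) : x != 0 -> 0 < dotp x x.
Proof.
move=> xN0; rewrite lt_def dotp_ge0 andbT; apply: contra_neq xN0.
move=> /eqP; rewrite psumr_eq0 => [/allP x0|i _]; last first.
  by rewrite -expr2 sqr_ge0.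
apply/colP => i; rewrite mxE; apply/eqP; rewrite -sqrf_eq0 expr2.
by apply: x0; rewrite mem_index_enum.
Qed.

Lemma norm2_sqr d (x : 'cV[R]_d) : norm2 x ^+ 2 = dotp x x.
Proof. by rewrite sqr_sqrtr ?dotp_ge0. Qed.

Lemma dotp_col_mx d e (x x' : 'cV[R]_d) (y y' : 'cV[R]_e) :
  dotp (col_mx x y) (col_mx x' y') = dotp x x' + dotp y y'.
Proof. by rewrite !dotpE tr_col_mx mul_row_col mxE. Qed.

Lemma dotp_mxcol s (n_ : 'I_s -> nat) (x y : forall i, 'cV[R]_(n_ i)) :
  dotp (\mxcol_i x i) (\mxcol_i y i) = \sum_i dotp (x i) (y i).
Proof.
rewrite dotpE tr_mxcol mul_mxrow_mxcol summxE.
by apply: eq_bigr => i _; rewrite dotpE.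
Qed.

(** Young's inequality, weighted so that both terms become quarters when
    [x] is the image of a vector under a matrix of spectral norm at most one
    half. *)
Lemma dotp_young d (x y : 'cV[R]_d) :
  `|dotp x y| <= dotp x x + 4^-1 * dotp y y.
Proof.
have := dotp_ge0 (x + 2^-1 *: y); have := dotp_ge0 (x - 2^-1 *: y).
rewrite !(dotpDl, dotpDr, dotpNl, dotpNr, dotpZl, dotpZr) (dotpC y x) => h1 h2.
rewrite ler_norml; apply/andP; split; lra.
Qed.

Lemma norm_entry_le d (x : 'cV[R]_d) i : `|x i 0| <= `|x|.
Proof.
rewrite [leRHS]/Num.norm /= mx_normrE.
exact: (le_bigmax _ (fun ij : 'I_d * 'I_1 => `|x ij.1 ij.2|) (i, 0)).
Qed.

Lemma norm_col_mx_le d e (x : 'cV[R]_d) (y : 'cV[R]_e) (r : R) :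
  `|x| <= r -> `|y| <= r -> `|col_mx x y| <= r.
Proof.
move=> xr yr; rewrite [leLHS]/Num.norm /= mx_normrE; apply/bigmax_leP.
split=> [|[i j] _ /=]; first exact: le_trans xr.
rewrite ord1; case: (split_ordP i) => k ->.
  by rewrite col_mxEu (le_trans (norm_entry_le _ _)).
by rewrite col_mxEd (le_trans (norm_entry_le _ _)).
Qed.

Lemma sqr_norm_le_dotp d (x : 'cV[R]_d) : `|x| ^+ 2 <= dotp x x.
Proof.
have [|/(mx_norm_neq0)[[i j]]] := eqVneq (mx_norm x) 0.
  by rewrite {1}/Num.norm /= => ->; rewrite expr0n dotp_ge0.
rewrite {2}/Num.norm /= => ->; rewrite ord1 real_normK ?num_real//.
rewrite /dotp (bigD1 i)//= -expr2 lerDl; apply: sumr_ge0 => k _.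
by rewrite -expr2 sqr_ge0.
Qed.

Lemma dotp_mulmx_bounded d e (M : 'M[R]_(d, e)) :
  exists2 c : R, 0 <= c &
    forall x y, `|dotp x (M *m y)| <= c * (`|x| * `|y|).
Proof.
exists (\sum_i \sum_j `|M i j|).
  by apply: sumr_ge0 => i _; apply: sumr_ge0 => j _.
move=> x y; rewrite mulr_suml; apply: le_trans (ler_norm_sum _ _ _) _.
apply: ler_sum => i _; rewrite mxE mulr_sumr mulr_suml.
apply: le_trans (ler_norm_sum _ _ _) _; apply: ler_sum => j _.
rewrite mulrCA !normrM ler_wpM2l// ler_pM// norm_entry_le//.
Qed.

End DotProduct.

(** * Symmetric matrices, square roots and the spectral norm *)

Section SymmetricMatrices.
Context {R : realType}.

Lemma poly_interpolation (F : fieldType) (s : seq F) (g : F -> F) :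
  exists p : {poly F}, forall x, x \in s -> p.[x] = g x.
Proof.
elim: s => [|x s [p pE]]; first by exists 0.
have [xs|xNs] := boolP (x \in s).
  by exists p => y; rewrite inE => /predU1P[->|]; exact: pE.
pose w := \prod_(y <- s) ('X - y%:P).
have wx : w.[x] != 0 by rewrite -rootE root_prod_XsubC.
exists (p + ((g x - p.[x]) / w.[x]) *: w) => y; rewrite !hornerE inE.
case/predU1P => [->|ys]; first by rewrite divfK// addrC subrK.
have /rootP-> : root w y by rewrite root_prod_XsubC.
by rewrite mulr0 addr0 pE.
Qed.

(** Over the complex numbers a real symmetric matrix is Hermitian, hence
    unitarily diagonalizable with a real diagonal [lam]; a real polynomial
    acts on the diagonal entrywise, so its value at [G] only depends on its
    values at [lam]. *)
Lemma horner_mx_spectrum d (G : 'M[R]_d.+1) : G^T = G ->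
  exists2 lam : 'I_d.+1 -> R, (forall i, eigenvalue G (lam i)) &
    forall p : {poly R}, (forall i, p.[lam i] = 0) -> horner_mx G p = 0.
Proof.
move=> Gsym; pose f := real_complex R; pose Gc := map_mx f G.
have GcH : Gc \is hermsymmx.
  apply: realsym_hermsym.
    apply/is_hermitianmxP; rewrite expr0 scale1r; apply/matrixP => i j.
    by rewrite !mxE -{1}Gsym mxE.
  by apply/mxOverP => i j; rewrite mxE complex_real.
have /mxOverP lamR := hermitian_spectral_diag_real GcH.
have /hermitian_normalmx /orthomx_spectralP := GcH.
have := spectral_unit Gc.
move: (spectralmx Gc) (spectral_diag Gc) lamR => P D lamR Pu GcE.
have DE i : D 0 i = f (complex.Re (D 0 i)).
  by rewrite /f RRe_real.
exists (fun i => complex.Re (D 0 i)).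
  move=> i; rewrite eigenvalue_root_char -(fmorph_root f) map_char_poly.
  rewrite -eigenvalue_root_char; apply/eigenvalueP; exists (row i P).
    suff : row i P *m Gc = D 0 i *: row i P by rewrite {1}DE.
    rewrite {1}GcE !mulmxA -row_mul mulmxV// -row_mul mul1mx.
    by rewrite row_diag_mx -scalemxAl -rowE.
  apply/eqP => rP0; have : delta_mx (0 : 'I_1) i = 0 :> 'rV[R[i]]_d.+1.
    by rewrite -[LHS](mulmxK Pu) -rowE rP0 mul0mx.
  by move=> /matrixP/(_ 0 i)/eqP; rewrite !mxE !eqxx oner_eq0.
move=> p p0; apply: (map_mx_inj (f := f)); rewrite map_horner_mx -/Gc GcE.
rewrite horner_mx_uconjC// horner_mx_diag map_mx0.
suff -> : map_mx (horner (map_poly f p)) D = 0.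
  by rewrite raddf0 mulmx0 mul0mx.
by apply/matrixP => i j; rewrite !mxE ord1 DE horner_map p0 rmorph0.
Qed.

Lemma trmx_horner_mx d (G : 'M[R]_d.+1) p : (horner_mx G p)^T = horner_mx G^T p.
Proof.
elim/poly_ind: p => [|p c IHp]; first by rewrite !rmorph0 trmx0.
rewrite !rmorphD !rmorphM /= !horner_mx_X !horner_mx_C linearD /= tr_scalar_mx.
congr (_ + _); rewrite [in LHS]trmx_mul IHp.
exact: (comm_mx_horner p (comm_mx_refl G^T)).
Qed.

(** The root is [p(G)], where the polynomial [p] interpolates the real fourth
    root on the spectrum. A fourth root rather than a square root, so that its
    square is a positive semidefinite square root. *)
Lemma sym_fourth_root d (G : 'M[R]_d) : G^T = G ->
    (forall a, eigenvalue G a -> 0 <= a) ->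
  exists2 Q : 'M[R]_d, Q^T = Q & (Q *m Q) *m (Q *m Q) = G.
Proof.
case: d G => [|d] G Gsym Gpos.
  by exists G => //; apply/matrixP => -[].
have [lam lamE lamP] := horner_mx_spectrum Gsym.
have [p pE] := poly_interpolation (codom lam) (Num.sqrt \o Num.sqrt).
exists (horner_mx G p); first by rewrite trmx_horner_mx Gsym.
apply/eqP; rewrite -subr_eq0 -{5}(horner_mx_X G).
rewrite -[_ *m _]/(_ * _) -[_ *m _]/(_ * _) -!rmorphM -rmorphB/=.
apply/eqP/lamP => i; rewrite !hornerE pE ?codom_f//= -!expr2.
have li := Gpos _ (lamE i); rewrite sqr_sqrtr ?sqrtr_ge0// -mulrA -expr2.
by rewrite sqr_sqrtr ?sqrtr_ge0// -expr2 sqr_sqrtr// subrr.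
Qed.

(** The difference [c - G] is the square of a symmetric matrix. *)
Lemma sym_quad_le d (G : 'M[R]_d) (c : R) : G^T = G ->
    (forall a, eigenvalue G a -> a <= c) ->
  forall x, dotp x (G *m x) <= c * dotp x x.
Proof.
move=> Gsym Gc x.
have [||Q Qsym QE] := @sym_fourth_root _ (c%:M - G).
- by rewrite linearB /= tr_scalar_mx Gsym.
- move=> a /eigenvalueP[v]; rewrite mulmxBr mul_mx_scalar => vE v0.
  rewrite -[a](subKr c) subr_ge0; apply: Gc; apply/eigenvalueP; exists v => //.
  by rewrite scalerBl -vE opprB addrC subrK.
have := dotp_ge0 (Q *m Q *m x).
rewrite {1}dotpC dotp_mulmxr trmx_mul Qsym mulmxA QE mulmxBl mul_scalar_mx.
by rewrite dotpDl dotpNl dotpZl subr_ge0 (dotpC _ x).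
Qed.

Lemma posdef_unitmx d (H : 'M[R]_d) : sym_posdef H -> H \in unitmx.
Proof.
move=> [Hsym Hpos]; rewrite -row_free_unit -kermx_eq0.
apply/rowV0P => v /sub_kermxP vH; apply/eqP; apply: contraT => v0.
have := Hpos v^T; rewrite trmx_eq0 => /(_ v0).
by rewrite -{1}Hsym -trmx_mul vH trmx0 dotp0r ltxx.
Qed.

Lemma posdef_sqrt d (H : 'M[R]_d) : sym_posdef H ->
  exists S : 'M[R]_d, sym_posdef S /\ S *m S = H.
Proof.
move=> Hpd; have [Hsym Hpos] := Hpd.
have [|Q Qsym QE] := sym_fourth_root Hsym.
  move=> a /eigenvalueP[v vE v0].
  have := Hpos v^T; rewrite trmx_eq0 => /(_ v0).
  rewrite -{1}Hsym -trmx_mul vE linearZ /= dotpZr => /ltW.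
  by rewrite pmulr_lge0// dotp_gt0// trmx_eq0.
exists (Q *m Q); split=> //; split; first by rewrite trmx_mul Qsym.
move=> x x0; rewrite -mulmxA dotp_mulmxr Qsym; apply: dotp_gt0.
apply: contraNneq x0 => Qx0.
have Hx0 : H *m x = 0 by rewrite -QE -!mulmxA Qx0 !mulmx0.
by rewrite -(mulKmx (posdef_unitmx Hpd) x) Hx0 mulmx0.
Qed.

Lemma sqrtmxP d (H : 'M[R]_d) : sym_posdef H ->
  sym_posdef (sqrtmx H) /\ sqrtmx H *m sqrtmx H = H.
Proof.
by move=> /posdef_sqrt[S SP]; rewrite /sqrtmx; case: xgetP => // /(_ S).
Qed.

(** The squares of the singular values are the eigenvalues of [N^T N], and the
    supremum is an upper bound because these eigenvalues are bounded by the
    size of the entries. *)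
Lemma spectral_norm_le d (N : 'M[R]_d) (c : R) : spectral_norm N <= c ->
  forall x, dotp (N *m x) (N *m x) <= c ^+ 2 * dotp x x.
Proof.
move=> Nc x; rewrite dotp_mulmxr mulmxA dotpC.
have Gsym : (N^T *m N)^T = N^T *m N by rewrite trmx_mul trmxK.
have nonneg a (v : 'rV[R]_d) : v *m (N^T *m N) = a *: v -> v != 0 -> 0 <= a.
  move=> vE v0; have vv : 0 < dotp v^T v^T by rewrite dotp_gt0 ?trmx_eq0.
  rewrite -(pmulr_lge0 _ vv) -dotpZl -linearZ /= -vE trmx_mul Gsym.
  by rewrite -mulmxA dotp_mulmxl trmxK dotp_ge0.
have [B B0 BP] := dotp_mulmx_bounded (N^T *m N).
apply: sym_quad_le => // a aE; have /eigenvalueP[v vE v0] := aE.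
have a0 := nonneg _ _ vE v0.
have sub : has_ubound (singular_value N).
  exists (B + 1) => t [t0] /eigenvalueP[w wE w0].
  have ww : 0 < dotp w^T w^T by rewrite dotp_gt0 ?trmx_eq0.
  suff : t ^+ 2 <= B by nra.
  rewrite -(ler_pM2r ww) -dotpZr -linearZ /= -wE trmx_mul Gsym.
  apply: le_trans (ler_norm _) _; apply: le_trans (BP _ _) _.
  by rewrite ler_wpM2l// -expr2 sqr_norm_le_dotp.
have st : singular_value N (Num.sqrt a).
  by split; rewrite ?sqrtr_ge0// sqr_sqrtr.
have := ub_le_sup sub st; rewrite -/(spectral_norm N) => /le_trans/(_ Nc) sc.
rewrite -[a]sqr_sqrtr// lerXn2r ?nnegrE ?sqrtr_ge0//.
exact: le_trans (sqrtr_ge0 _) sc.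
Qed.


End SymmetricMatrices.

(** * Existence and variational characterization of proximal points *)

Section Proximity.
Context {R : realType}.

Lemma seq_ereal_argmin (T : eqType) (g : T -> \bar R) (x0 : T) (r : seq T) :
  exists2 x, x \in x0 :: r & forall y, y \in x0 :: r -> (g x <= g y)%E.
Proof.
elim: r x0 => [|x1 r IHr] x0.
  by exists x0; rewrite ?mem_head// => y /[!inE]/eqP->.
have [x xr xmin] := IHr x1; have [gx|/ltW gx] := leP (g x0) (g x).
  exists x0; rewrite ?mem_head// => y /[!inE]/predU1P[->//|].
  by rewrite -in_cons => /xmin; exact: le_trans.
exists x; first by rewrite inE xr orbT.
by move=> y /[!inE]/predU1P[->//|]; rewrite -in_cons; exact: xmin.
Qed.

(** If the minimum were not attained, the open sets [f w < f _], with [w] in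
    [K], would cover [K]; a finite subcover misses the best of its own
    indices. *)
Lemma lsc_min_compact (T : ptopologicalType) (f : T -> \bar R) (K : set T) :
    lower_semicontinuous f -> (forall x, f x != -oo%E) ->
    compact K -> K !=set0 ->
  exists2 u, K u & forall w, K w -> (f u <= f w)%E.
Proof.
move=> /lower_semicontinuousP f_lsc fNy; rewrite compact_cover => Kco [x0 Kx0].
apply: contrapT => /forall2NP nomin.
have worse u : K u -> exists2 w, K w & (f w < f u)%E.
  move=> Ku; case: (nomin u) => // /existsNP[w /not_implyP[Kw]].
  by move=> /negP; rewrite -ltNge; exists w.
have [w _|u Ku|D DK Dcov] := Kco _ K (fun w => [set x | (f w < f x)%E]).
- case fw : (f w) => [r| |]; first exact: f_lsc.
    rewrite (_ : mkset _ = set0); first exact: open0.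
    by apply/seteqP; split => x //=; rewrite ltNge leey.
  by move: (fNy w); rewrite fw.
- by have [w Kw fw] := worse u Ku; exists w.
have [d0 Dd0 _] := Dcov _ Kx0.
have [u uD umin] := seq_ereal_argmin f d0 (enum_fset D).
have Du : [set` D] u by move: uD; rewrite inE => /predU1P[->|].
have Ku : K u by apply: set_mem; exact: (DK _ Du).
have [w Dw /=] := Dcov _ Ku; rewrite ltNge umin// inE.
by apply/orP; right; exact: Dw.
Qed.

Lemma trmx_continuous d : continuous (fun v : 'rV[R]_d => v^T : 'cV[R]_d).
Proof.
move=> v A /nbhs_ballP[e e0 eA]; apply/nbhs_ballP; exists e => // w [_ vw].
by apply: eA; split=> // i j; rewrite !mxE; exact: vw.
Qed.

Lemma cV_ball_compact d (u : 'cV[R]_d) (r : R) : 0 < r ->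
  compact [set x : 'cV[R]_d | `|x - u| <= r].
Proof.
move=> r0; have cpt : compact
    [set v : 'rV[R]_d | forall i, v 0 i \in `[(u i 0 - r), (u i 0 + r)]].
  apply: (@rV_compact _ _ (fun i => `[(u i 0 - r), (u i 0 + r)]%classic)).
  by move=> i; exact: segment_compact.
have := continuous_compact (continuous_subspaceT (@trmx_continuous d)) cpt.
move=> /subclosed_compact; apply.
  have -> : [set x : 'cV[R]_d | `|x - u| <= r] = closed_ball u r.
    by rewrite closed_ballE//; apply/seteqP; split=> x /=; rewrite distrC.
  exact: closed_ball_closed.
move=> x /= xu; exists x^T; last by rewrite trmxK.
move=> i; rewrite in_itv /= mxE -ler_distl.
by have := norm_entry_le (x - u) i; rewrite !mxE => /le_trans; exact.
Qed.

Lemma econvex_fin d (f : 'cV[R]_d -> \bar R) x y (a b t : R) :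
    econvex f -> f x = a%:E -> f y = b%:E -> 0 < t < 1 ->
  (f (t *: x + (1 - t) *: y)%R <= (t * a + (1 - t) * b)%:E)%E.
Proof. by move=> fc fx fy t01; have := fc x y t t01; rewrite fx fy. Qed.

Lemma Gamma0_fin_point d (f : 'cV[R]_d -> \bar R) : Gamma0 f ->
  exists u a, f u = a%:E.
Proof.
case=> [[fNy [u fu]]] _ _; exists u, (fine (f u)).
by rewrite fineK// fin_numE fNy -ltey.
Qed.

(** [f] is bounded below by some [l] on the unit ball around a point [u] of its
    domain; sliding towards [u] along segments, convexity spreads this bound
    to the whole space at the price of a term linear in the distance. *)
Lemma Gamma0_linear_lower_bound d (f : 'cV[R]_d -> \bar R) : Gamma0 f ->
  exists u, exists a l : R, [/\ f u = a%:E, l <= a &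
    forall x, ((l - (a - l) * `|x - u|)%:E <= f x)%E].
Proof.
move=> fG; have [[fNy _] f_lsc f_cvx] := fG.
have [u [a fu]] := Gamma0_fin_point fG.
have ball_u : [set x : 'cV[R]_d | `|x - u| <= 1] u by rewrite /= subrr normr0.
have [p p1 pmin] := lsc_min_compact f_lsc fNy (@cV_ball_compact _ u _ ltr01)
  (ex_intro _ u ball_u).
have : (f p <= a%:E)%E by rewrite -fu pmin.
case fp : (f p) => [l| |] //; last by move: (fNy p); rewrite fp.
rewrite lee_fin => la; exists u, a, l; split=> // x.
have [x1|x1] := leP `|x - u| 1.
  apply: le_trans (_ : l%:E <= _)%E; last by rewrite -fp pmin.
  by rewrite lee_fin gerBl mulr_ge0// subr_ge0.
case fx : (f x) => [b| |]; last by move: (fNy x); rewrite fx.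
  set r := `|x - u| in x1 *; have r0 : 0 < r by exact: lt_trans x1.
  have t01 : 0 < r^-1 < 1 by rewrite invr_gt0 r0 invf_lt1.
  have /(le_trans _) := econvex_fin f_cvx fx fu t01.
  move=> /(_ l%:E); rewrite !lee_fin -(ler_pM2r r0) => H.
  have {H} : l * r <= (r^-1 * b + (1 - r^-1) * a) * r.
    apply: H; rewrite -fp; apply: pmin => /=.
    have -> : r^-1 *: x + (1 - r^-1) *: u - u = r^-1 *: (x - u).
      by rewrite scalerBl scale1r scalerBr addrAC addrA subrK.
    by rewrite normrZ gtr0_norm ?invr_gt0// mulVf// gt_eqF.
  have -> : (r^-1 * b + (1 - r^-1) * a) * r = b + (r - 1) * a.
    by field; rewrite gt_eqF.
  nra.
by rewrite leey.
Qed.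

Lemma dotp_shift_continuous d (z : 'cV[R]_d) :
  continuous (fun x : 'cV[R]_d => dotp (x - z) (x - z)).
Proof.
apply: (@continuous_big R _ _ 0 _ (@add_continuous R)) => i _ x.
have cv : (fun y : 'cV[R]_d => (y - z) i 0) @ x --> (x - z) i 0.
  rewrite [X in _ --> X]mxE; under eq_fun do rewrite mxE.

  have cx : (fun y : 'cV[R]_d => y i 0) @ x --> x i 0.
    exact: coord_continuous.
  exact: (cvgD cx (cvg_cst _)).
exact: (cvgM cv cv).
Qed.

Definition prox_objective d (c : R) (f : 'cV[R]_d -> \bar R) (z u : 'cV[R]_d) :=
  ((2^-1 * norm2 (u - z) ^+ 2)%:E + escale c f u)%E.

Lemma prox_objective_fin d (c : R) (f : 'cV[R]_d -> \bar R) z u (a : R) :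
  f u = a%:E ->
  prox_objective c f z u = (2^-1 * dotp (u - z) (u - z) + c * a)%:E.
Proof. by move=> fu; rewrite /prox_objective /escale norm2_sqr fu. Qed.

Lemma prox_objective_pinfty d (c : R) (f : 'cV[R]_d -> \bar R) z u :
  0 < c -> f u = +oo%E -> prox_objective c f z u = +oo%E.
Proof. by move=> c0 fu; rewrite /prox_objective /escale fu gt0_muley. Qed.

Lemma prox_objective_lsc d (c : R) (f : 'cV[R]_d -> \bar R) z :
    0 < c -> (forall x, f x != -oo%E) -> lower_semicontinuous f ->
  lower_semicontinuous (prox_objective c f z).
Proof.
move=> c0 fNy f_lsc x a ax.
pose q (y : 'cV[R]_d) := 2^-1 * dotp (y - z) (y - z).
(* A level [b] below [f x] that still leaves the sum above [a]: split the
   excess in half if [f x] is finite, choose [b] freely otherwise. *)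
have [b bx bq] : exists2 b : R, (b%:E < f x)%E & a < q x + c * b.
  case fx : (f x) => [r| |]; last by move: (fNy x); rewrite fx.
    move: ax; rewrite (prox_objective_fin c z fx) lte_fin -/(q x) => ax.
    exists (r - (q x + c * r - a) / (2 * c)).
      by rewrite lte_fin gtrBl divr_gt0 ?mulr_gt0// subr_gt0.
    have -> : q x + c * (r - (q x + c * r - a) / (2 * c)) =
        (q x + c * r + a) / 2.
      by field; rewrite gt_eqF.
    lra.
  exists ((a - q x) / c + 1); first by rewrite ltry.
  have -> : q x + c * ((a - q x) / c + 1) = a + c by field; rewrite gt_eqF.
  by rewrite ltrDl.
have [V Vx Vb] := f_lsc x b bx.
have qc : q @ x --> q x 
  by exact: (cvgM (cvg_cst _) (@dotp_shift_continuous d z x)).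
exists (V `&` [set y | a - c * b < q y]).
  apply: filterI => //; apply: (qc [set r | a - c * b < r]).
  by apply: open_nbhs_nbhs; split; [exact: open_gt|rewrite /=; lra].
move=> y [Vy /= aq]; have := Vb y Vy; case fy : (f y) => [r| |] //.
  rewrite (prox_objective_fin c z fy) !lte_fin -/(q y) -(ltr_pM2l c0) => cb.
  lra.
by move=> _; rewrite prox_objective_pinfty// ltry.
Qed.

(** The quadratic term dominates the linear lower bound of [f], so that only a
    ball matters. *)
Lemma prox_objective_argmin d (c : R) (f : 'cV[R]_d -> \bar R) z :
  0 < c -> Gamma0 f -> argmin (prox_objective c f z) !=set0.
Proof.
move=> c0 fG; have [[fNy _] f_lsc f_cvx] := fG.
have [u [a [l [fu la lb]]]] := Gamma0_linear_lower_bound fG.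
have phiNy x : prox_objective c f z x != -oo%E.
  case fx : (f x) => [r| |]; last by move: (fNy x); rewrite fx.
    by rewrite (prox_objective_fin c z fx).
  by rewrite prox_objective_pinfty.
pose A := 2^-1 * dotp (u - z) (u - z) + c * a.
have phiu : prox_objective c f z u = A%:E by exact: prox_objective_fin.
pose delta := `|z - u|; pose k := c * (a - l).
have k0 : 0 <= k by rewrite mulr_ge0 ?subr_ge0// ltW.
pose B : R := `|A - c * l|.
(* Beyond this radius [r / 2] exceeds [delta + k + B], hence the quadratic term
   beats the linear one by at least [B]. *)
pose rho : R := 2 * (delta + k) + 2 * (B + 1).
have d0 : 0 <= delta by exact: normr_ge0.
have B0 : 0 <= B by exact: normr_ge0.
have rho0 : 0 < rho by rewrite /rho; lra.
have Ku : [set x : 'cV[R]_d | `|x - u| <= rho] u.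
  by rewrite /= subrr normr0 ltW.
have [p _ pmin] := lsc_min_compact
  (prox_objective_lsc (z := z) c0 fNy f_lsc) phiNy
  (@cV_ball_compact _ u _ rho0) (ex_intro _ u Ku).
exists p => x; have [/pmin//|xrho] := leP `|x - u| rho.
apply: le_trans (pmin _ Ku) _; rewrite phiu.
case fx : (f x) => [b| |]; last by move: (fNy x); rewrite fx.
  rewrite (prox_objective_fin c z fx) lee_fin.
  have := lb x; rewrite fx lee_fin; move: xrho; set r := `|x - u| => xrho.
  rewrite -(ler_pM2l c0) => cb.
  have rd : r - delta <= `|x - z|.
    by rewrite lerBlDr; apply: le_trans (ler_normD _ _); rewrite addrA subrK.
  have rd0 : 0 <= r - delta by rewrite /rho in xrho; lra.
  have xz : (r - delta) ^+ 2 <= dotp (x - z) (x - z).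
    by apply: le_trans (sqr_norm_le_dotp _); rewrite lerXn2r ?nnegrE.
  have AB : A - c * l <= B by exact: ler_norm.
  have kr : k * r = c * ((a - l) * r) by rewrite /k mulrA.
  have key : B <= 2^-1 * (r - delta) ^+ 2 - k * r.
    have : 0 <= (r - rho) * r.
      by apply: mulr_ge0; [rewrite subr_ge0 ltW|exact: normr_ge0].
    have : 0 <= (r - 1) * B by apply: mulr_ge0 => //; rewrite /rho in xrho; lra.
    rewrite /rho in xrho *; nra.
  lra.
by rewrite prox_objective_pinfty// leey.
Qed.

Lemma affine_ge0 (X Y : R) : 0 <= Y ->
  (forall t, 0 < t < 1 -> 0 <= X + t * Y) -> 0 <= X.
Proof.
move=> Y0 XY; rewrite leNgt; apply/negP => X0.
(* Any [t] below [- X / Y] is a counterexample; this one avoids dividing by a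
   vanishing [Y] and stays below 1. *)
have D0 : 0 < Y + 1 - X by lra.
have /XY : 0 < - X / (Y + 1 - X) < 1.
  by rewrite divr_gt0 ?oppr_gt0//= ltr_pdivrMr// mul1r; lra.
have -> : X + - X / (Y + 1 - X) * Y = X * (1 - X) / (Y + 1 - X).
  by field; rewrite gt_eqF.
by rewrite leNgt pmulr_llt0 ?invr_gt0// nmulr_rlt0//; lra.
Qed.

(** Fermat's rule for the proximal subproblem: comparing the minimizer [p] with
    the points of the segment from [p] to [u], to first order, shows that
    [(z - p) / c] is a subgradient of [f] at [p]. *)
Lemma prox_subgradient d (c : R) (f : 'cV[R]_d -> \bar R) z :
    0 < c -> Gamma0 f -> let p := prox (escale c f) z in
  f p \is a fin_num /\
  forall u, (f p + (c^-1 * dotp (z - p) (u - p))%:E <= f u)%E.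
Proof.
move=> c0 fG p; have [[fNy _] f_lsc f_cvx] := fG.
have pmin : argmin (prox_objective c f z) p.
  have [q qmin] := prox_objective_argmin z c0 fG.
  by rewrite /p /prox; case: xgetP => // /(_ q).
have [u0 [a fu0]] := Gamma0_fin_point fG.
case fp : (f p) => [b| |]; last by move: (fNy p); rewrite fp.
  split=> // u; case fu : (f u) => [e| |]; last by move: (fNy u); rewrite fu.
    rewrite -EFinD lee_fin -subr_ge0 -(pmulr_rge0 _ c0).
    have -> : c * (e - (b + c^-1 * dotp (z - p) (u - p))) =
        c * (e - b) - dotp (z - p) (u - p) by field; rewrite gt_eqF.
    apply: (@affine_ge0 _ (2^-1 * dotp (u - p) (u - p))).
      by rewrite mulr_ge0// dotp_ge0.
    move=> t t01; have /andP[t0 _] := t01.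
    have := econvex_fin f_cvx fu fp t01.
    set w := _ + _ => fw.
    case fwE : (f w) fw => [h| |] //; last by move: (fNy w); rewrite fwE.
    rewrite lee_fin => hle.
    have := pmin w; rewrite (prox_objective_fin c z fp).
    rewrite (prox_objective_fin c z fwE) lee_fin.
    have -> : w - z = t *: (u - p) - (z - p).
      by apply/colP => i; rewrite !mxE; ring.
    rewrite -[p - z]opprB; move: (u - p) (z - p) => U Z.
    rewrite !(dotpDl, dotpDr, dotpNl, dotpNr, dotpZl, dotpZr) (dotpC U Z).
    move: (dotp Z Z) (dotp Z U) (dotp U U) => zz zu uu ineq.
    rewrite -(pmulr_rge0 _ t0); have := ler_pM2l c0 h (t * e + (1 - t) * b).
    rewrite hle => ch.
    nra.
  by rewrite leey.
by move: (pmin u0); rewrite (prox_objective_fin c z fu0) prox_objective_pinfty.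
Qed.

End Proximity.

(** * The energy estimate *)

Section Energy.
Context {R : realType} {d : nat}.
Variables (M0 M1 M2 : 'M[R]_d).
Hypothesis M_cond : condition_M M0 M1 M2.

Let H := M0 + M2.

(** With [S] the square root of [H] and [N] the matrix whose spectral norm is
    controlled, [M2 = S N S], so the form of [M2] becomes that of [N] on the
    images under [S]. *)
Lemma cross_term_le (a e : 'cV[R]_d) :
  `|dotp a (M2 *m e)| <= 4^-1 * (dotp a (H *m a) + dotp e (H *m e)).
Proof.
have [_ Hpd /ltW normN] := M_cond.
have [Spd SE] := sqrtmxP Hpd.
have Su := posdef_unitmx Spd; have [Ssym _] := Spd.
set S := sqrtmx H in Spd SE Su Ssym.
have [N {}normN SNS] : exists2 N : 'M[R]_d,
    spectral_norm N <= 2^-1 & M2 = S *m (N *m S).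
  exists (invsqrtmx H *m M2 *m invsqrtmx H) => //.
  by rewrite /invsqrtmx -/S mulmxKV// mulKVmx.
have normS w : dotp w (H *m w) = dotp (S *m w) (S *m w).
  by rewrite dotp_mulmxl Ssym mulmxA SE.
rewrite SNS -!mulmxA dotp_mulmxr Ssym dotpC !normS.
apply: le_trans (dotp_young _ _) _.
have := spectral_norm_le normN (S *m e).
have -> : 2^-1 ^+ 2 = 4^-1 :> R by field.
lra.
Qed.

(** A Lyapunov function for the scheme: the squared [H]-distance from the
    iterate to [p], with inertial corrections that make it decrease. *)
Definition energy (p v1 v0 : 'cV[R]_d) : R :=
  2^-1 * dotp (p - v1) (H *m (p - v1)) + dotp (p - v1) (M2 *m (v1 - v0)) +
  4^-1 * dotp (v1 - v0) (H *m (v1 - v0)).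

Lemma energy_ge0 p v1 v0 : 0 <= energy p v1 v0.
Proof.
have [_ [_ Hpos] _] := M_cond.
have Hge0 w : 0 <= dotp w (H *m w).
  by have [->|/Hpos/ltW//] := eqVneq w 0; rewrite mulmx0 dotp0r.
have := cross_term_le (p - v1) (v1 - v0); rewrite ler_norml /energy.
by have := Hge0 (p - v1); move=> h1 /andP[h2 h3]; lra.
Qed.

(** Writing [e] for [p - v2] and [d2], [d1] for the last two increments, the
    first argument on the left is [H d2 - M2 (d2 - d1)]; the [H]-terms
    telescope by the cosine law, those in [M2] up to [dotp d2 (M2 *m d1)]. *)
Lemma energy_step p v2 v1 v0 :
  dotp (M0 *m v2 - M1 *m v1 - M2 *m v0) (p - v2)
    <= energy p v1 v0 - energy p v2 v1.
Proof.
have [M0E [Hsym _] _] := M_cond; rewrite -/H in Hsym.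
pose e := p - v2; pose d2 := v2 - v1; pose d1 := v1 - v0.
have -> : M0 *m v2 - M1 *m v1 - M2 *m v0 = H *m d2 - M2 *m d2 + M2 *m d1.
  rewrite /H M0E /d2 /d1 !(mulmxDl, mulmxDr, mulmxN).
  by apply/colP => i; rewrite !mxE; ring.
rewrite /energy; have -> : p - v1 = e + d2 by rewrite addrA subrK.
rewrite -/e -/d2 -/d1; clearbody e d2 d1.
have /andP[+ _] : - (4^-1 * (dotp d2 (H *m d2) + dotp d1 (H *m d1)))
    <= dotp d2 (M2 *m d1)
    <= 4^-1 * (dotp d2 (H *m d2) + dotp d1 (H *m d1)).
  by rewrite -ler_norml cross_term_le.
have Hswap : dotp d2 (H *m e) = dotp e (H *m d2).
  by rewrite dotp_mulmxr Hsym dotpC.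
rewrite !(mulmxDr, dotpDl, dotpDr, dotpNl) Hswap ![dotp (_ *m _) e]dotpC.
lra.
Qed.

Lemma energy_bounded (r : R) v1 v0 :
  exists c, forall p, `|p| <= r -> energy p v1 v0 <= c.
Proof.
have [cH cH0 cHP] := dotp_mulmx_bounded H.
have [cM cM0 cMP] := dotp_mulmx_bounded M2.
pose r' := r + `|v1|.
exists (2^-1 * (cH * (r' * r')) + cM * (r' * `|v1 - v0|) +
        4^-1 * dotp (v1 - v0) (H *m (v1 - v0))) => p pr.
have pr' : `|p - v1| <= r'.
  by apply: le_trans (ler_normB _ _) _; rewrite lerD2r.
rewrite /energy lerD2r; apply: lerD.
  rewrite ler_wpM2l ?invr_ge0//; apply: le_trans (ler_norm _) _.
  by apply: le_trans (cHP _ _) _; rewrite ler_wpM2l// ler_pM.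
apply: le_trans (ler_norm _) _; apply: le_trans (cMP _ _) _.
by rewrite ler_wpM2l// ler_wpM2r.
Qed.

End Energy.

(** * Averages, suprema and infima *)

Section Averages.
Context {R : realType}.

(** Jensen's inequality for uniform weights, by peeling off the last point with
    weight [1 / K.+2]. *)
Lemma econvex_mean d (g : 'cV[R]_d -> \bar R) (x : nat -> 'cV[R]_d)
    (r : nat -> R) : econvex g -> (forall k, g (x k) = (r k)%:E) ->
  forall K, (g (K.+1%:R^-1 *: \sum_(k < K.+1) x k)%R
             <= (K.+1%:R^-1 * \sum_(k < K.+1) r k)%:E)%E.
Proof.
move=> gc gx; elim=> [|K IHK].
  by rewrite !big_ord1 invr1 scale1r mul1r gx.
pose t : R := K.+2%:R^-1.
have K1 : K.+1%:R != 0 :> R by rewrite pnatr_eq0.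
have K2 : K.+2%:R != 0 :> R by rewrite pnatr_eq0.
have t01 : 0 < t < 1 by rewrite /t invr_gt0 ltr0n invf_lt1 ?ltr0n// ltr1n.
have tE : (1 - t) * K.+1%:R^-1 = t.
  by rewrite /t -[K.+2%:R]natr1; field; rewrite !nat1r natr1 K2.
rewrite big_ord_recr [in X in (_ <= X)%E]big_ord_recr /=.
set X := \sum_(k < K.+1) x k in IHK *; set Y := \sum_(k < K.+1) r k in IHK *.
have -> : K.+2%:R^-1 *: (X + x K.+1) =
    t *: x K.+1 + (1 - t) *: (K.+1%:R^-1 *: X).
  by rewrite scalerA tE scalerDr addrC.
have -> : K.+2%:R^-1 * (Y + r K.+1) = t * r K.+1 + (1 - t) * (K.+1%:R^-1 * Y).
  by rewrite mulrA tE mulrDr addrC.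
apply: le_trans (gc _ _ _ t01) _; rewrite gx [in leRHS]EFinD !EFinM.
by rewrite leeD2l// lee_pmul2l// lte_fin subr_gt0; case/andP: t01.
Qed.

Lemma ereal_sup_sub_inf_le (S T : set (\bar R)) (c : R) :
    (forall a b, S a -> T b -> (a <= b + c%:E)%E) ->
  (ereal_sup S - ereal_inf T <= c%:E)%E.
Proof.
move=> ST; have suple b : T b -> (ereal_sup S - c%:E <= b)%E.
  by move=> Tb; rewrite leeBlDr//; apply: ge_ereal_sup => a Sa; exact: ST.
have : (ereal_sup S - c%:E <= ereal_inf T)%E by exact: le_ereal_inf_tmp.
case: (ereal_sup S) => [p| |]; case: (ereal_inf T) => [q| |] //=.
- by rewrite -!EFinB !lee_fin; lra.
all: by rewrite ?leNye.
Qed.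

End Averages.

(** * One step of the scheme and the ergodic mean *)

Section Iteration.
Context {R : realType} {s m : nat} {n_ : 'I_s -> nat}.
Variables (f : forall i, 'cV[R]_(n_ i) -> \bar R).
Variables (A : forall i, 'M[R]_(m, n_ i)) (b : 'cV[R]_m).
Variables (alpha : 'I_s -> R) (beta : R).
Hypothesis f_Gamma0 : forall i, Gamma0 (@f i).
Hypothesis alpha_gt0 : forall i, 0 < alpha i.
Hypothesis beta_gt0 : 0 < beta.

Local Notation n := (\sum_(i < s) n_ i)%N.

Lemma submxcolZ (a : R) (x : 'cV[R]_n) i :
  submxcol (a *: x) i = a *: submxcol x i.
Proof. by apply/matrixP => k l; rewrite !mxE. Qed.

Lemma fsum_neqNy x : fsum f x != -oo%E.
Proof.
apply/eqP => /esum_eqNyP[i [_ _ fi]].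
by have [[/(_ (submxcol x i))]] := f_Gamma0 i; rewrite fi.
Qed.

Lemma econvex_fsum : econvex (fsum f).
Proof.
move=> x y t t01.
have fNy i z : @f i z != -oo%E by have [[]] := f_Gamma0 i.
have sumZ (c : R) z :
    (c%:E * fsum f z)%E = (\sum_(i < s) c%:E * f (submxcol z i))%E.
  apply: fin_num_sume_distrr => // i j _ _.
  by rewrite /adde_def !negb_and !fNy !orbT.
rewrite !sumZ -big_split /=; apply: lee_sum => i _.
rewrite submxcolD !submxcolZ; have [_ _] := f_Gamma0 i.
exact.
Qed.

Lemma iotaC_conjE y : iotaC_conj b y = (dotp b y)%:E.
Proof.
apply/eqP; rewrite eq_le; apply/andP; split.
  apply: ge_ereal_sup => _ [x _ <-]; rewrite /indicator.
  case: ifPn => [|_]; last by rewrite addeNy leNye.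
  by rewrite inE => ->; rewrite sube0.
apply: ereal_sup_ubound; exists b => //=.
by rewrite /indicator ifT ?inE// sube0.
Qed.

(** Being linear, the conjugate falls under the same subgradient inequality as
    the [f i], so the multiplier block is treated like the others. *)
Lemma iotaC_conj_Gamma0 : Gamma0 (@iotaC_conj R m b).
Proof.
split.
- by split=> [y|]; [|exists 0]; rewrite iotaC_conjE ?ltry.
- move=> y a; rewrite iotaC_conjE lte_fin => ay.
  have bc : (dotp b : 'cV[R]_m -> R) @ y --> dotp b y.
    apply: (@continuous_big R _ _ 0 _ (@add_continuous R)) => i _ x.
    have cx : (fun y : 'cV[R]_m => y i 0) @ x --> x i 0.
      exact: coord_continuous.
    exact: (cvgM (cvg_cst _) cx).
  exists [set z | a < dotp b z].
    apply: (bc [set r | a < r]); apply: open_nbhs_nbhs.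
    by split=> //; exact: open_gt.
  by move=> z /= az; rewrite iotaC_conjE lte_fin.
- move=> x y t _; rewrite !iotaC_conjE -!EFinM -EFinD lee_fin.
  by rewrite dotpDr !dotpZr.
Qed.

Lemma Pmx_unit : Pmx (n_ := n_) alpha beta \in unitmx.
Proof.
rewrite -row_free_unit /row_free /Pmx rank_mxdiag; apply/eqP.
apply: eq_bigr => i _; apply: mxrank_unit; rewrite unitmxE det_scalar.
by rewrite unitrX// unitfE gt_eqF// divr_gt0.
Qed.

Lemma Rmx_unit : Rmx (m := m) (n_ := n_) alpha beta \in unitmx.
Proof.
rewrite block_diag_mx_unit Pmx_unit unitmxE det_scalar unitrX// unitfE.
by rewrite invr_eq0 gt_eqF.
Qed.

Lemma submxcol_Pmx (x : 'cV[R]_n) i :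
  submxcol (Pmx (n_ := n_) alpha beta *m x) i
    = (beta / alpha i) *: submxcol x i.
Proof.
by rewrite -{1}[x]submxcolK mul_mxdiag_mxcol mxcolK mul_scalar_mx.
Qed.

Lemma Rmx_Emx (v : 'cV[R]_(n + m)) :
  Rmx alpha beta *m (Emx A alpha beta *m v) =
  col_mx (Pmx alpha beta *m usubmx v - (Amx A)^T *m dsubmx v)
         (Amx A *m usubmx v + beta^-1 *: dsubmx v).
Proof.
rewrite mulmxA mulmx_block -{1}[v]vsubmxK mul_block_col.
rewrite !(mul0mx, mulmx1, addr0, add0r) mulmxN mulmxA.
rewrite mulmxV ?Pmx_unit// mul1mx mulNmx.
by rewrite -scalemxAr !mul_scalar_mx scalerA divff ?gt_eqF// scale1r.
Qed.

(** Multiplying the argument of [Tmap] by [Rmx] removes all inverses, and the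
    subgradients produced by the proximity operators sum up to the residual
    [q] paired with the displacement: the bilinear terms in [A] cancel as in
    any primal-dual method. *)
Lemma scheme_step_gap_le (M0 M1 M2 : 'M[R]_(n + m))
    (v2 v1 v0 : 'cV[R]_(n + m)) :
    scheme_step f A b alpha beta M0 M1 M2 v2 v1 v0 ->
  fsum f (usubmx v2) \is a fin_num /\
  forall (x' : 'cV[R]_n) (y' : 'cV[R]_m),
    (fsum f (usubmx v2) +
      (dotp (Amx A *m usubmx v2 - b) y' + dotp (b - Amx A *m x') (dsubmx v2)
       - dotp (M0 *m v2 - M1 *m v1 - M2 *m v0) (col_mx x' y' - v2))%:E
     <= fsum f x')%E.
Proof.
rewrite /scheme_step; set w := _ + _ + _; set q := _ - _ - _ => v2E.
have RwE : Rmx alpha beta *m w = Rmx alpha beta *m (Emx A alpha beta *m v2) - q.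
  rewrite /w mulmxBl !mulmxDr mulmxN -!mulmxA !mulKVmx ?Rmx_unit//.
  by rewrite /q !opprD !opprK !addrA.
rewrite -{1}[w]vsubmxK mul_block_col !mul0mx add0r addr0 in RwE.
rewrite Rmx_Emx -[q]vsubmxK opp_col_mx add_col_mx in RwE.
have [PwE ywE] := eq_col_mx RwE.
set x := usubmx v2 in PwE ywE *; set y := dsubmx v2 in PwE ywE *.
have xE i : submxcol x i =
    prox (escale (alpha i / beta) (@f i)) (submxcol (usubmx w) i).
  by rewrite /x v2E /Tmap col_mxKu mxcolK.
have yE : y = prox (escale beta (iotaC_conj b)) (dsubmx w).
  by rewrite /y v2E /Tmap col_mxKd.
have xsub i := prox_subgradient (submxcol (usubmx w) i)
  (divr_gt0 (alpha_gt0 i) beta_gt0) (f_Gamma0 i).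
have [_ ysub] := prox_subgradient (dsubmx w) beta_gt0 iotaC_conj_Gamma0.
have xfin : fsum f x \is a fin_num.
  by apply/sum_fin_numP => i _ _; rewrite xE; case: (xsub i).
split=> // x' y'.
have {}ysub : dotp b y + dotp (Amx A *m x - dsubmx q) (y' - y) <= dotp b y'.
  have := ysub y'; rewrite -yE !iotaC_conjE -EFinD lee_fin -dotpZl.
  rewrite scalerBr -mul_scalar_mx ywE.
  suff -> : Amx A *m x + beta^-1 *: y - dsubmx q - beta^-1 *: y =
            Amx A *m x - dsubmx q by [].
  by rewrite addrAC addrK.
have {}xsub : (fsum f x +
    (dotp (- ((Amx A)^T *m y) - usubmx q) (x' - x))%:E <= fsum f x')%E.
  rewrite -[X in dotp X]submxcolK -[X in dotp _ X]submxcolK dotp_mxcol.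
  rewrite /fsum -sumEFin -big_split /=; apply: lee_sum => i _.
  have [_ /(_ (submxcol x' i))] := xsub i; rewrite -xE => /(le_trans _); apply.
  rewrite leeD2l// lee_fin invf_div -dotpZl scalerBr.
  rewrite -!submxcol_Pmx PwE -!submxcolB.
  suff -> : Pmx alpha beta *m x - (Amx A)^T *m y - usubmx q -
    Pmx alpha beta *m x = - ((Amx A)^T *m y) - usubmx q by [].
  by apply/colP => k; rewrite !mxE; ring.
apply: le_trans xsub; rewrite leeD2l// lee_fin.
have -> : col_mx x' y' - v2 = col_mx (x' - x) (y' - y).
  by rewrite -[in LHS](vsubmxK v2) opp_col_mx add_col_mx.
have -> : dotp q (col_mx (x' - x) (y' - y)) =
    dotp (usubmx q) (x' - x) + dotp (dsubmx q) (y' - y).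
  by rewrite -{1}[q]vsubmxK dotp_col_mx.
move: ysub; rewrite !(dotpDl, dotpDr, dotpNl, dotpNr).
rewrite ![dotp ((Amx A)^T *m y) _]dotpC !dotp_mulmxr trmxK.
rewrite ![dotp (_ *m _) y]dotpC.
lra.
Qed.

(** The part of the Lagrangian difference besides [fsum] is affine in [v], so
    averaging commutes with it; the energies telescope. *)
Lemma gap_ergodic_mean (M0 M1 M2 : 'M[R]_(n + m)) v :
    condition_M M0 M1 M2 ->
    (forall k, scheme_step f A b alpha beta M0 M1 M2 (v k.+2) (v k.+1) (v k)) ->
  forall K (x' : 'cV[R]_n) (y' : 'cV[R]_m), (0 < K)%N ->
  let vb := ergodic_mean v K in
  fsum f (usubmx vb) \is a fin_num /\
  (fsum f (usubmx vb) +
     (dotp (Amx A *m usubmx vb - b) y' + dotp (b - Amx A *m x') (dsubmx vb)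
      - energy M0 M2 (col_mx x' y') (v 1%N) (v 0%N) / K%:R)%:E
   <= fsum f x')%E.
Proof.
move=> Mc vs [//|K] x' y' _ vb.
pose r k := fine (fsum f (usubmx (v k.+2))).
have rE k : fsum f (usubmx (v k.+2)) = (r k)%:E.
  by rewrite fineK//; have [] := scheme_step_gap_le (vs k).
have vbE : vb = K.+1%:R^-1 *: \sum_(k < K.+1) v k.+2.
  rewrite /vb /ergodic_mean -[2%N]add0n big_addn subn2 /= big_mkord.
  by congr (_ *: _); apply: eq_bigr => k _; rewrite addn2.
have ub : usubmx vb = K.+1%:R^-1 *: \sum_(k < K.+1) usubmx (v k.+2).
  by rewrite vbE linearZ linear_sum.
have := econvex_mean econvex_fsum rE K; rewrite -ub => jensen.
have fin : fsum f (usubmx vb) \is a fin_num.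
  by rewrite fin_numE fsum_neqNy -ltey (le_lt_trans jensen)// ltry.
split=> //; case fx' : (fsum f x') => [r'| |]; last 2 first.
- by rewrite leey.
- by have := fsum_neqNy x'; rewrite fx'.
move: jensen; rewrite -(fineK fin); set rb := fine _.
rewrite -EFinD !lee_fin => jensen.
(* The affine part is the product with [w] up to a constant. *)
pose w := col_mx ((Amx A)^T *m y') (b - Amx A *m x').
have lin (u : 'cV[R]_(n + m)) : dotp (Amx A *m usubmx u - b) y' +
    dotp (b - Amx A *m x') (dsubmx u) = dotp w u - dotp b y'.
  rewrite -[in RHS](vsubmxK u) dotp_col_mx [dotp (_ - b) y']dotpDl dotpNl.
  rewrite [dotp (_ *m usubmx u) y']dotp_mulmxl.
  by rewrite [dotp (usubmx u) _]dotpC addrAC.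
pose e k := energy M0 M2 (col_mx x' y') (v k.+1) (v k).
have step k : r k + dotp w (v k.+2) <= r' + dotp b y' + (e k - e k.+1).
  have [_ /(_ x' y')] := scheme_step_gap_le (vs k).
  rewrite fx' rE -EFinD lee_fin lin.
  have := energy_step Mc (col_mx x' y') (v k.+2) (v k.+1) (v k).
  rewrite -/(e k) -/(e k.+1); lra.
have total : \sum_(k < K.+1) r k + dotp w (\sum_(k < K.+1) v k.+2)
    <= (r' + dotp b y') * K.+1%:R + e 0%N.
  rewrite dotp_sumr -big_split /=.
  apply: le_trans (ler_sum _ (fun (k : 'I_K.+1) _ => step k)) _.
  rewrite big_split /= sumr_const card_ord mulr_natr lerD2l.
  rewrite -(big_mkord xpredT (fun k => e k - e k.+1)).
  under eq_bigr do rewrite -opprB.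
  rewrite sumrN telescope_sumr// opprB gerBl.
  exact: (energy_ge0 Mc).
rewrite lin -/(e 0%N) vbE dotpZr.
have K0 : 0 < K.+1%:R :> R by rewrite ltr0n.
rewrite -(ler_pM2l (_ : 0 < K.+1%:R^-1)) ?invr_gt0// in total.
have tE : K.+1%:R^-1 * ((r' + dotp b y') * K.+1%:R + e 0%N) =
    r' + dotp b y' + e 0%N / K.+1%:R by field; rewrite gt_eqF.
rewrite tE mulrDr in total; move: jensen total.
move: (_ * (\sum_(k < _) r k)) (_ * dotp w _) (e 0%N / _) => p1 p2 p3.
lra.
Qed.

End Iteration.

Theorem theorem5p5 (R : realType) (s m : nat) (n_ : 'I_s -> nat)
  (s_gt0 : (0 < s)%N) (m_gt0 : (0 < m)%N) (n_gt0 : forall i, (0 < n_ i)%N)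
  (f : forall i, 'cV[R]_(n_ i) -> \bar R)
  (A : forall i, 'M[R]_(m, n_ i)) (b : 'cV[R]_m)
  (f_Gamma0 : forall i, Gamma0 (f i))
  (has_solution : exists x, solution f A b x)
  (b_ri : exists2 x, ri (dom (fsum f)) x & Amx A *m x = b)
  (alpha : 'I_s -> R) (beta : R)
  (alpha_gt0 : forall i, 0 < alpha i) (beta_gt0 : 0 < beta)
  (M0 M1 M2 : 'M[R]_(\sum_(i < s) n_ i + m))
  (well_defined : forall v1 v0 : 'cV[R]_(\sum_(i < s) n_ i + m),
    exists! v2, scheme_step f A b alpha beta M0 M1 M2 v2 v1 v0)
  (v : nat -> 'cV[R]_(\sum_(i < s) n_ i + m))
  (v_scheme : forall k : nat,
    scheme_step f A b alpha beta M0 M1 M2 (v k.+2) (v k.+1) (v k))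
  (M_cond : condition_M M0 M1 M2)
  (B1 : set 'cV[R]_(\sum_(i < s) n_ i)) (B2 : set 'cV[R]_m)
  (B1_bounded : bounded_set B1) (B2_bounded : bounded_set B2) :
  exists c : R, forall K : nat, (0 < K)%N ->
    (partial_gap f A b B1 B2 (ergodic_mean v K) <= (c / K%:R)%:E)%E.
Proof.
have [r1 r1_gt0 r1P] := pinfty_ex_gt0 B1_bounded.
have [r2 r2_gt0 r2P] := pinfty_ex_gt0 B2_bounded.
have [c cP] := energy_bounded M0 M2 (Num.max r1 r2) (v 1%N) (v 0%N).
exists c => K K0; apply: ereal_sup_sub_inf_le => _ _ [y' By' <-] [x' Bx' <-].
have [fin] := gap_ergodic_mean f_Gamma0 alpha_gt0 beta_gt0 M_cond v_scheme
  x' y' K0.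
set vb := ergodic_mean v K in fin *; rewrite -(fineK fin) !iotaC_conjE.
have := fsum_neqNy f_Gamma0 x'; case: (fsum f x') => [r'| |] //= _.
  rewrite -!(EFinD, EFinN) !lee_fin => gap.
  have eK : energy M0 M2 (col_mx x' y') (v 1%N) (v 0%N) / K%:R <= c / K%:R.
    rewrite ler_pM2r ?invr_gt0 ?ltr0n//; apply: cP.
    by apply: norm_col_mx_le; rewrite le_max ?r1P ?r2P ?orbT.
  move: gap; rewrite !(dotpDl, dotpNl); lra.
by move=> _; rewrite leey.
Qed.
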